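(* Let $G$ be a weakly branch group acting on a rooted tree $T$, and suppose that every proper quotient of $G$ is in $\mathcal{MF}$. If $M<G$ is a maximal subgroup of $G$ of infinite index, then $M_v$ is a maximal subgroup of infinite index of $G_v$ for every vertex $v\in T$.
   Context: All rooted trees are infinite and locally finite. For a rooted tree $T$, the $n$-th level $L_n$ is the set of vertices at distance $n$ from the root, and for vertices $v,w$ one writes $v\leq w$ if $v$ lies on the simple path from the root to $w$; $T_v$ is the subtree with vertex set $\{w : v\leq w\}$, rooted at $v$. $T$ is spherically homogeneous if all vertices of the same level have the same degree. $\mathrm{Aut}(T)$ is the group of automorphisms of $T$ fixing the root. For $G\leq \mathrm{Aut}(T)$ and a vertex $v$, $\mathrm{St}_G(v)$ is the stabiliser of $v$ in $G$, and $\varphi_v:\mathrm{St}_{\mathrm{Aut}(T)}(v)\to \mathrm{Aut}(T_v)$ is the homomorphism restricting the action to $T_v$. Put $G_v=\varphi_v(\mathrm{St}_G(v))\leq \mathrm{Aut}(T_v)$; likewise $M_v=\varphi_v(\mathrm{St}_M(v))$ for any subgroup $M\leq G$. The rigid stabiliser $\mathrm{Rist}_G(v)$ is the subgroup of all $g\in G$ fixing every vertex outside $T_v$. A weakly branch group acting on $T$ is a subgroup $G\leq\mathrm{Aut}(T)$, with $T$ a spherically homogeneous rooted tree, such that $G$ acts transitively on every level $L_n$ and $\mathrm{Rist}_G(v)\neq\{1\}$ for every vertex $v$. $\mathcal{MF}$ is the class of groups all of whose maximal subgroups have finite index. A proper quotient of $G$ is a quotient $G/N$ by a non-trivial normal subgroup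 $N$. *)

(* Defs.v *)
From HB Require Import structures.
From mathcomp Require Import all_boot.
From mathcomp Require Import mathcomp_extra boolp classical_sets functions cardinality.

Set Implicit Arguments.
Unset Strict Implicit.
Unset Printing Implicit Defensive.

Local Open Scope classical_set_scope.
Local Open Scope card_scope.
Local Open Scope group_scope.

(** * Groups

   Groups are MathComp's [groupType]s (possibly infinite), and a subgroup of
   [gT] is a [groupClosed gT], i.e. a boolean predicate bundled with its
   closure properties. *)

Section Subgroups.
Variable gT : groupType.

Definition lcoset (x : gT) (H : {pred gT}) : set gT := [set x * h | h in [set` H]].

Definition finite_index (H G : {pred gT}) : Prop :=
  finite_set [set lcoset g H | g in [set` G]].

Definition maximal_subgroup (M G : {pred gT}) : Prop :=
  [/\ {subset M <= G}, ~ {subset G <= M} &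
      forall K : groupClosed gT, {subset M <= K} -> {subset K <= G} ->
        K =i M \/ K =i G].

Definition normal_subgroup (N G : {pred gT}) : Prop :=
  {subset N <= G} /\ {in N & G, forall n g, n ^ g \in N}.

Definition nontrivial (H : {pred gT}) : Prop := exists2 h, h \in H & h <> 1.

End Subgroups.

Definition MF (gT : groupType) : Prop :=
  forall M : groupClosed gT,
    maximal_subgroup M predT -> finite_index M predT.

(** The quotient G / N, as the group of left cosets of N by elements of G with
   the elementwise product of sets. *)

Section Quotient.
Variables (gT : groupType) (G N : groupClosed gT).

Record quotient (nNG : normal_subgroup N G) : Type := Coset {
  coset_set :> set gT;
  coset_setP : exists2 x, x \in G & coset_set = lcoset x N }.

Variable nNG : normal_subgroup N G.

Local Notation Q := (quotient nNG).

Lemma quotient_inj (A B : Q) : A = B :> set gT -> A = B.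
Proof.
by case: A B => [A hA] [B hB] /= eAB; subst B; congr Coset; apply: Prop_irrelevance.
Qed.

Lemma mem_lcoset x y : lcoset x N y <-> x^-1 * y \in N.
Proof.
split=> [[h /= hN <-]|h]; first by rewrite mulKg.
by exists (x^-1 * y) => //; rewrite mulVKg.
Qed.

Definition coset x (xG : x \in G) : Q := @Coset nNG _ (ex_intro2 _ _ x xG erefl).

Lemma quotientP (A : Q) : exists x (xG : x \in G), A = coset xG.
Proof.
by case: A => A [x xG eA]; exists x, xG; apply: quotient_inj.
Qed.

Lemma lcosetM x y : y \in G ->
  [set a * b | a in lcoset x N & b in lcoset y N] = lcoset (x * y) N.
Proof.
move=> yG; apply/seteqP; split=> [_ [_ [m mN <-]] [_ [n nN <-] <-]|_ [n nN <-]].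
  exists (m ^ y * n); last by rewrite -!mulgA mulVKg.
  by rewrite /= gpredM// nNG.2.
by exists x; [exists 1; rewrite /= ?gpred1 ?mulg1|exists (y * n); [exists n|rewrite mulgA]].
Qed.

Lemma lcosetV x : x \in G -> [set a^-1 | a in lcoset x N] = lcoset x^-1 N.
Proof.
move=> xG; apply/seteqP; split=> [_ [_ [n nN <-] <-]|_ [n nN <-]].
  exists (n^-1 ^ x^-1); last by rewrite conjgE invgK invgM !mulgA mulVg mul1g.
  by rewrite /= nNG.2// gpredV.
exists (x * n^-1 ^ x); last by rewrite conjgE mulVKg invgM invgK.
by exists (n^-1 ^ x) => //=; rewrite nNG.2// gpredV.
Qed.

Lemma lcoset1 : [set` N] = lcoset 1 N.
Proof.
by apply/seteqP; split=> [n nN|_ [n nN <-]]; [exists n; rewrite ?mul1g|rewrite mul1g].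
Qed.

Fact quotient_mul_subproof (A B : Q) :
  exists2 x, x \in G & [set a * b | a in A & b in B] = lcoset x N.
Proof.
have [x [xG ->]] := quotientP A; have [y [yG ->]] := quotientP B.
by exists (x * y); [exact: gpredM|rewrite lcosetM].
Qed.

Fact quotient_inv_subproof (A : Q) :
  exists2 x, x \in G & [set a^-1 | a in A] = lcoset x N.
Proof.
by have [x [xG ->]] := quotientP A; exists x^-1; [rewrite gpredV|rewrite lcosetV].
Qed.

Fact quotient_one_subproof : exists2 x, x \in G & [set` N] = lcoset x N.
Proof. by exists 1; [exact: gpred1|exact: lcoset1]. Qed.

Definition quotient_mul (A B : Q) : Q := Coset nNG (quotient_mul_subproof A B).
Definition quotient_inv (A : Q) : Q := Coset nNG (quotient_inv_subproof A).
Definition quotient_one : Q := Coset nNG quotient_one_subproof.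

Lemma coset_mul x (xG : x \in G) y (yG : y \in G) :
  quotient_mul (coset xG) (coset yG) = coset (gpredM x y xG yG).
Proof. by apply: quotient_inj; rewrite /= lcosetM. Qed.

Fact quotient_mulA : associative quotient_mul.
Proof.
move=> A B C.
have [x [xG ->]] := quotientP A; have [y [yG ->]] := quotientP B.
have [z [zG ->]] := quotientP C.
by rewrite !coset_mul; apply: quotient_inj; rewrite /= mulgA.
Qed.

Fact quotient_mul1 : left_id quotient_one quotient_mul.
Proof.
move=> A; have [x [xG ->]] := quotientP A.
by apply: quotient_inj; rewrite /= lcoset1 lcosetM// mul1g.
Qed.

Fact quotient_mulr1 : right_id quotient_one quotient_mul.
Proof.
move=> A; have [x [xG ->]] := quotientP A.
by apply: quotient_inj; rewrite /= lcoset1 lcosetM ?mulg1 ?gpred1.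
Qed.

Fact quotient_mulV : left_inverse quotient_one quotient_inv quotient_mul.
Proof.
move=> A; have [x [xG ->]] := quotientP A.
by apply: quotient_inj; rewrite /= lcosetV// lcosetM// mulVg lcoset1.
Qed.

Fact quotient_mulrV : right_inverse quotient_one quotient_inv quotient_mul.
Proof.
move=> A; have [x [xG ->]] := quotientP A.
by apply: quotient_inj; rewrite /= lcosetV// lcosetM ?gpredV// mulgV lcoset1.
Qed.

HB.instance Definition _ := gen_eqMixin Q.
HB.instance Definition _ := gen_choiceMixin Q.
HB.instance Definition _ := isGroup.Build Q
  quotient_mulA quotient_mul1 quotient_mulr1 quotient_mulV quotient_mulrV.

End Quotient.

(** * Rooted trees *)

Record rooted_graph : Type := RootedGraph {
  vertex :> eqType;
  root : vertex;
  adj : rel vertex }.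

Arguments root {_}.
Arguments adj {_}.

Section RootedGraphs.
Variable X : rooted_graph.
Implicit Types (x y : X) (p : seq X).

(* A path from x to y is given by the list p of its vertices other than x. *)
Definition is_path x y p : bool := path adj x p && (last x p == y).

Definition simple_path x y p : bool := is_path x y p && uniq (x :: p).

Definition neighbours x : set X := [set y | adj x y].

Definition is_distance x y (n : nat) : Prop :=
  (exists2 p, is_path x y p & size p = n) /\
  (forall p, is_path x y p -> (n <= size p)%N).

Definition level (n : nat) : set X := [set x | is_distance root x n].

Definition spherically_homogeneous : Prop :=
  forall n x y, level n x -> level n y -> neighbours x #= neighbours y.

End RootedGraphs.

Record rooted_tree : Type := RootedTree {
  tree_graph :> rooted_graph;
  adj_sym : symmetric (@adj tree_graph);
  adj_irr : irreflexive (@adj tree_graph);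
  tree_path : forall x y : tree_graph, exists! p, simple_path x y p;
  tree_infinite : infinite_set [set: tree_graph];
  tree_locally_finite : forall x : tree_graph, finite_set (neighbours x) }.

(** * Automorphisms *)

Section Automorphisms.
Variable X : rooted_graph.

Record Aut : Type := MkAut {
  aut_fun :> X -> X;
  aut_bij : bijective aut_fun;
  aut_adj : forall x y, adj (aut_fun x) (aut_fun y) = adj x y;
  aut_root : aut_fun root = root }.

Lemma aut_inj (f g : Aut) : f =1 g -> f = g.
Proof.
case: f g => [f f1 f2 f3] [g g1 g2 g3] /= /funext efg; subst g.
by congr MkAut; apply: Prop_irrelevance.
Qed.

Definition aut_one : Aut :=
  @MkAut idfun (Bijective (fun=> erefl) (fun=> erefl))
         (fun _ _ => erefl) erefl.

Fact aut_mul_adj (f g : Aut) x y : adj ((f \o g) x) ((f \o g) y) = adj x y.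
Proof. by rewrite /= !aut_adj. Qed.

Fact aut_mul_root (f g : Aut) : (f \o g) root = root.
Proof. by rewrite /= !aut_root. Qed.

Definition aut_mul (f g : Aut) : Aut :=
  MkAut (bij_comp (aut_bij f) (aut_bij g)) (aut_mul_adj f g) (aut_mul_root f g).

Fact aut_inv_subproof (f : Aut) : exists g : Aut, cancel f g /\ cancel g f.
Proof.
have [g fK gK] := aut_bij f.
have gadj x y : adj (g x) (g y) = adj x y by rewrite -(aut_adj f) !gK.
have groot : g root = root by rewrite -[in LHS](aut_root f) fK.
by exists (MkAut (Bijective gK fK) gadj groot).
Qed.

Definition aut_inv (f : Aut) : Aut := sval (cid (aut_inv_subproof f)).

Lemma aut_invK (f : Aut) : cancel f (aut_inv f).
Proof. by case: (svalP (cid (aut_inv_subproof f))). Qed.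

Lemma aut_invVK (f : Aut) : cancel (aut_inv f) f.
Proof. by case: (svalP (cid (aut_inv_subproof f))). Qed.

Fact aut_mulA : associative aut_mul.
Proof. by move=> f g h; apply: aut_inj. Qed.
Fact aut_mul1 : left_id aut_one aut_mul.
Proof. by move=> f; apply: aut_inj. Qed.
Fact aut_mulr1 : right_id aut_one aut_mul.
Proof. by move=> f; apply: aut_inj. Qed.
Fact aut_mulV : left_inverse aut_one aut_inv aut_mul.
Proof. by move=> f; apply: aut_inj => x; exact: aut_invK. Qed.
Fact aut_mulrV : right_inverse aut_one aut_inv aut_mul.
Proof. by move=> f; apply: aut_inj => x; exact: aut_invVK. Qed.

HB.instance Definition _ := gen_eqMixin Aut.
HB.instance Definition _ := gen_choiceMixin Aut.
HB.instance Definition _ :=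
  isGroup.Build Aut aut_mulA aut_mul1 aut_mulr1 aut_mulV aut_mulrV.

Lemma autM (f g : Aut) x : (f * g) x = f (g x). Proof. by []. Qed.
Lemma aut1 x : (1 : Aut) x = x. Proof. by []. Qed.
Lemma autVK (f : Aut) x : f^-1 (f x) = x. Proof. exact: aut_invK. Qed.
Lemma autKV (f : Aut) x : f (f^-1 x) = x. Proof. exact: aut_invVK. Qed.

Lemma aut_is_path (f : Aut) x y p :
  is_path x y p -> is_path (f x) (f y) (map f p).
Proof.
move=> /andP[xp /eqP <-]; rewrite /is_path last_map eqxx andbT.
by rewrite path_map; apply: sub_path xp => a b; rewrite /= aut_adj.
Qed.

Lemma aut_simple_path (f : Aut) x y p :
  simple_path x y p -> simple_path (f x) (f y) (map f p).
Proof.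
move=> /andP[/(aut_is_path f) xp up]; rewrite /simple_path xp.
rewrite (_ : f x :: map f p = map f (x :: p))// map_inj_uniq//.
exact: bij_inj (aut_bij f).
Qed.

End Automorphisms.

(** * Subtrees and the restriction maps *)

Section Subtrees.
Variable T : rooted_tree.
Implicit Types (v w : T) (g h : Aut T) (G : groupClosed (Aut T)).

Definition tree_le v w : bool :=
  `[< exists2 p, simple_path root w p & v \in root :: p >].

Lemma tree_le_refl v : tree_le v v.
Proof.
apply/asboolP; have [p [hp _]] := tree_path root v; exists p => //.
by case/andP: hp => /andP[_ /eqP <-] _; exact: mem_last.
Qed.

Definition subtree v : rooted_graph :=
  {| vertex := {w : T | tree_le v w};
     root := exist _ v (tree_le_refl v);
     adj := fun x y => adj (val x) (val y) |}.

Definition sub_vertex v w (vw : tree_le v w) : subtree v := exist _ w vw.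

Lemma tree_le_aut g v w : tree_le v w -> tree_le (g v) (g w).
Proof.
move=> /asboolP[p hp vp]; apply/asboolP; exists (map g p).
  by rewrite -[root](aut_root g); exact: aut_simple_path.
by rewrite -[root](aut_root g); exact: (map_f g vp).
Qed.

Lemma tree_le_fix g v : g v = v -> forall w : subtree v, tree_le v (g (val w)).
Proof. by move=> gv w; rewrite -{1}gv tree_le_aut//; exact: valP w. Qed.

Section Restriction.
Variables (v : T) (g : Aut T) (gv : g v = v).

Definition restr_fun (w : subtree v) : subtree v := sub_vertex (tree_le_fix gv w).

Fact restr_bij : bijective restr_fun.
Proof.
have gVv : g^-1 v = v by rewrite -[in LHS]gv autVK.
exists (fun w : subtree v => sub_vertex (tree_le_fix gVv w)) => w; apply: val_inj => /=.
  exact: autVK.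
exact: autKV.
Qed.

Fact restr_adj x y : adj (restr_fun x) (restr_fun y) = adj x y.
Proof. exact: aut_adj. Qed.

Fact restr_root : restr_fun root = root.
Proof. exact: val_inj. Qed.

Definition restr : Aut (subtree v) := MkAut restr_bij restr_adj restr_root.

End Restriction.

(* The homomorphism phi_v, whose actual domain is the stabiliser of v; it is
   extended by the value 1 outside of it. *)
Definition phi v g : Aut (subtree v) :=
  if pselect (g v = v) is left gv then restr gv else 1.

Lemma phiE v g (w : subtree v) : g v = v -> val (phi v g w) = g (val w).
Proof. by rewrite /phi; case: pselect. Qed.

Lemma phiM v g h : g v = v -> h v = v -> phi v (g * h) = phi v g * phi v h.
Proof.
move=> gv hv; apply: aut_inj => w; apply: val_inj.
by rewrite autM !phiE// autM hv.
Qed.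

Lemma phi1 v : phi v 1 = 1.
Proof. by apply: aut_inj => w; apply: val_inj; rewrite phiE. Qed.

Lemma fix_inv v g : g v = v -> g^-1 v = v.
Proof. by move=> gv; rewrite -[in LHS]gv autVK. Qed.

Lemma phiV v g : g v = v -> phi v g^-1 = (phi v g)^-1.
Proof.
move=> gv; apply: (@mulgI _ (phi v g)).
by rewrite -phiM ?fix_inv// !mulgV phi1.
Qed.

Section Stabilisers.
Variables (G : groupClosed (Aut T)) (v : T).

Definition St : {pred Aut T} := [pred g | (g \in G) && (g v == v)].

Fact St1 : 1 \in St.
Proof. by rewrite inE gpred1 aut1 eqxx. Qed.
Fact StM : mulg_closed St.
Proof.
move=> g h /andP[gG /eqP gv] /andP[hG /eqP hv].
by rewrite inE gpredM// autM hv gv eqxx.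
Qed.
Fact StV : invg_closed St.
Proof. by move=> g /andP[gG /eqP gv]; rewrite inE gpredV gG fix_inv ?eqxx. Qed.

HB.instance Definition _ := isMulClosed.Build _ St StM.
HB.instance Definition _ := isMul1Closed.Build _ St St1.
HB.instance Definition _ := isInvClosed.Build _ St StV.

(* The group G_v of the mathematical notation. *)
Definition vertex_group : {pred Aut (subtree v)} :=
  [pred h | `[< exists2 g, g \in St & phi v g = h >]].

Fact vertex_group1 : 1 \in vertex_group.
Proof. by apply/asboolP; exists 1; [exact: St1|exact: phi1]. Qed.
Fact vertex_groupM : mulg_closed vertex_group.
Proof.
move=> _ _ /asboolP[g gS <-] /asboolP[h hS <-]; apply/asboolP.
exists (g * h); first exact: StM.
by case/andP: gS hS => _ /eqP gv /andP[_ /eqP hv]; exact: phiM.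
Qed.
Fact vertex_groupV : invg_closed vertex_group.
Proof.
move=> _ /asboolP[g gS <-]; apply/asboolP; exists g^-1; first exact: StV.
by case/andP: gS => _ /eqP gv; exact: phiV.
Qed.

HB.instance Definition _ := isMulClosed.Build _ vertex_group vertex_groupM.
HB.instance Definition _ := isMul1Closed.Build _ vertex_group vertex_group1.
HB.instance Definition _ := isInvClosed.Build _ vertex_group vertex_groupV.

Definition Rist : {pred Aut T} :=
  [pred g | (g \in G) && `[< forall w, ~~ tree_le v w -> g w = w >]].

Fact Rist1 : 1 \in Rist.
Proof. by rewrite inE gpred1; apply/asboolP. Qed.
Fact RistM : mulg_closed Rist.
Proof.
move=> g h /andP[gG /asboolP gv] /andP[hG /asboolP hv].
by rewrite inE gpredM//; apply/asboolP => w vw; rewrite autM hv ?gv.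
Qed.
Fact RistV : invg_closed Rist.
Proof.
move=> g /andP[gG /asboolP gv]; rewrite inE gpredV gG.
by apply/asboolP => w vw; rewrite -[in LHS](gv w vw) autVK.
Qed.

HB.instance Definition _ := isMulClosed.Build _ Rist RistM.
HB.instance Definition _ := isMul1Closed.Build _ Rist Rist1.
HB.instance Definition _ := isInvClosed.Build _ Rist RistV.

End Stabilisers.

Definition level_transitive G : Prop :=
  forall n v w, level n v -> level n w -> exists2 g, g \in G & g v = w.

Definition weakly_branch G : Prop :=
  [/\ spherically_homogeneous T, level_transitive G &
      forall v, nontrivial (Rist G v)].

End Subtrees.

Arguments phi {T} v g.
Arguments St {T} G v.
Arguments vertex_group {T} G v _.
Arguments Rist {T} G v.

(* Main.v *)
Require Import Defs.
From HB Require Import structures.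
From mathcomp Require Import all_boot.
From mathcomp Require Import mathcomp_extra boolp classical_sets functions cardinality.

(** Since M has infinite index and proper quotients of G are in MF, M contains no
   nontrivial normal subgroup of G, so that G = M N for every nontrivial normal N.
   Taking for N the pointwise stabiliser of a ball shows that M approximates
   every element of G up to any given depth.

   M_v is proper: if M_v = G_v then M_u = G_u for all u on the level of v.  Among
   the nontrivial elements of M fixing that level, take c acting nontrivially on
   as few of the subtrees T_u of that level as possible.  If there were two of
   them, T_u and T_u', a suitable commutator [[c, m1^-1], h m2 h^-1] would act
   trivially on T_u but not on T_u'.  So c lies in Rist_M(u), and as M_u = G_u all
   G-conjugates of c lie in M: the core of M in G is nontrivial, a contradiction.

   M_v is maximal of infinite index: for a subgroup K containing M_v, the elements
   g of G such that every m2 g m1 (m1, m2 in M) stabilising v acts on T_v through K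
   form a subgroup containing M, hence equal to M or G.  In the first case
   K = M_v because G_v = M_v Rist_G(v), in the second case K = G_v.  For K = M_v
   the subgroup is M, and finitely many cosets of M_v in G_v determine the coset
   of an element of G modulo it. *)

Set Implicit Arguments.
Unset Strict Implicit.
Unset Printing Implicit Defensive.

Local Open Scope classical_set_scope.
Local Open Scope group_scope.

(** * Maximal subgroups and quotients *)

(** Packs a [Prop]-valued condition as a bundled subgroup, by classical decidability; the auxiliary
    subgroups below are built this way. *)
Lemma groupClosedP (gT : groupType) (P : gT -> Prop) :
  P 1 -> (forall x y, P x -> P y -> P (x * y)) -> (forall x, P x -> P x^-1) ->
  exists H : groupClosed gT, forall x, x \in H <-> P x.
Proof.
move=> P1 PM PV; pose H : {pred gT} := [pred x | `[< P x >]].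
have H1 : 1 \in H by apply/asboolP.
have HM : mulg_closed H by move=> x y /asboolP Px /asboolP Py; apply/asboolP/PM.
have HV : invg_closed H by move=> x /asboolP Px; apply/asboolP/PV.
pose i1 := isMulClosed.Build _ H HM.
pose i2 := isMul1Closed.Build _ H H1.
pose i3 := isInvClosed.Build _ H HV.
pose K : groupClosed gT := HB.pack H i1 i2 i3.
by exists K => x; split=> /asboolP.
Qed.

Section MaximalSubgroups.
Variables (gT : groupType) (G M : groupClosed gT).

(** Elements of [G] with equal value lie in one coset, so the union [g (f x)] of the cosets of all
    elements with value [f x] is just the coset of [x]. *)
Lemma finite_index_of_separation (I : finType) (f : gT -> I) :
  {in G &, forall x y, f x = f y -> x^-1 * y \in M} -> finite_index M G.
Proof.
move=> fM; pose g (i : I) : set gT :=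
  [set y | exists2 x, x \in G & f x = i /\ lcoset x M y].
apply: sub_finite_set (finite_image g (@finite_finset I setT)).
move=> _ [x /= xG <-]; exists (f x) => //; apply/seteqP; split=> [y|y yx].
  move=> [z zG [fzx [m mM <-]]]; exists (x^-1 * z * m); last by rewrite -mulgA mulVKg.
  by rewrite /= gpredM// fM.
by exists x.
Qed.

Lemma finite_index_transversal : finite_index M G ->
  exists (I : finType) (f : gT -> I),
    {in G &, forall x y, f x = f y -> x^-1 * y \in M}.
Proof.
move=> /finite_seqP [s es].
(* The label of [x] is the position of its coset in the enumeration [s]; [.+1] makes the ordinal
   type inhabited, as [inord] requires. *)
exists 'I_(size s).+1, (fun x => inord (index (lcoset x M) s)) => x y xG yG.
have xs z : z \in G -> lcoset z M \in s.
  by move=> zG; have : [set` s] (lcoset z M) by rewrite -es; exists z.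
move=> /(congr1 val); rewrite /= !inordK ?ltnS ?index_size// => e.
have : lcoset x M = lcoset y M.
  by rewrite -[LHS](nth_index set0 (xs _ xG)) e nth_index// xs.
move=> exy; have : lcoset y M y by exists 1; rewrite ?mulg1 //= gpred1.
by rewrite -exy => -[m mM <-]; rewrite mulKg.
Qed.

Hypothesis maxM : maximal_subgroup M G.

(** Correspondence theorem: the image [Q] of [M] in G/N is maximal, since an overgroup [K] of [Q]
    has as preimage an overgroup [K'] of [M]. Finite index then lifts from [Q] to [M]. *)
Lemma maximal_quotient (N : groupClosed gT) (nNG : normal_subgroup N G) :
  {subset N <= M} -> MF (quotient nNG) -> finite_index M G.
Proof.
move=> NM mfQ; have [MG nGM maxK] := maxM.
have memQ x (xG : x \in G) : coset_set (coset nNG xG) x.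
  by exists 1; rewrite ?mulg1 //= gpred1.
have memQE x (xG : x \in G) (A : quotient nNG) : coset_set A x -> A = coset nNG xG.
  have [y [yG ->]] := quotientP A => -[n nN] /= e; apply: quotient_inj => /=.
  rewrite -e; apply/seteqP; split=> [_ [k kN <-]|_ [k kN <-]].
    exists (n^-1 * k); first by rewrite /= gpredM ?gpredV.
    by rewrite -mulgA mulVKg.
  by exists (n * k); rewrite ?mulgA //= gpredM.
have [|||Q QP] := @groupClosedP (quotient nNG)
  (fun A => exists2 x, x \in M & coset_set A x).
- by exists 1; rewrite ?gpred1//= gpred1.
- move=> A B [x xM Ax] [y yM By]; exists (x * y); first exact: gpredM.
  by exists x => //; exists y.
- move=> A [x xM Ax]; exists x^-1; first by rewrite gpredV.
  by exists x.
have QM x (xG : x \in G) : coset nNG xG \in Q <-> x \in M.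
  split=> [/QP [y yM [n nN e]]|xM]; last by apply/QP; exists x.
  have xE : x = y * n^-1 by rewrite -e mulgK.
  by rewrite xE; apply: gpredM => //; rewrite gpredV NM.
have maxQ : maximal_subgroup Q predT.
  split=> // [QT|K QK _].
    by apply: nGM => x xG; apply/(QM x xG)/QT.
  have [|||K' K'P] := @groupClosedP gT
    (fun x => exists2 A : quotient nNG, A \in K & coset_set A x).
  - by exists 1; [exact: gpred1 | rewrite /= gpred1].
  - move=> x y [A AK Ax] [B BK By]; exists (A * B); first exact: gpredM.
    by exists x => //; exists y.
  - by move=> x [A AK Ax]; exists A^-1; [rewrite gpredV | exists x].
  have K'G : {subset K' <= G}.
    move=> x /K'P [A _]; have [y [yG ->]] := quotientP A => -[n nN <-].
    by rewrite gpredM// nNG.1.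
  have K'E x (xG : x \in G) : x \in K' <-> coset nNG xG \in K.
    split=> [/K'P [A AK /(memQE _ xG) <-]//|xK]; apply/K'P.
    by exists (coset nNG xG).
  have MK' : {subset M <= K'}.
    by move=> x xM; apply/(K'E x (MG _ xM))/QK/QM.
  have [K'M|K'G'] := maxK K' MK' K'G; [left|right] => A;
    have [y [yG ->]] := quotientP A.
    by apply/idP/idP => [/K'E|]; [rewrite K'M => /QM|exact: QK].
  by rewrite inE; apply/K'E; rewrite K'G'.
have finQ := mfQ Q maxQ.
(* As [N] lies in [M], the union of the [Q]-coset of x N is the [M]-coset of x. *)
pose F (C : set (quotient nNG)) : set gT := [set x | exists2 A, C A & coset_set A x].
apply: sub_finite_set (finite_image F finQ) => _ [x /= xG <-].
exists (lcoset (coset nNG xG) Q); first by exists (coset nNG xG).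
apply/seteqP; split=> [y [_ [A /QP [m mM Am] <-]]|_ [m mM <-]].
  have e : coset nNG xG * coset nNG (MG _ mM) = coset nNG (gpredM _ _ xG (MG _ mM)).
    exact: coset_mul.
  rewrite (memQE _ (MG _ mM) _ Am) e => -[n nN <-].
  by exists (m * n); [rewrite /= gpredM// NM | rewrite mulgA].
exists (coset nNG (gpredM _ _ xG (MG _ mM))); last exact: memQ.
exists (coset nNG (MG _ mM)); first exact/QM.
exact: coset_mul.
Qed.

(** By normality M N is a subgroup; it contains [M] and differs from it, so maximality makes it
    [G]. *)
Lemma maximal_mul_normal (N : groupClosed gT) (nNG : normal_subgroup N G) :
  ~ {subset N <= M} ->
  forall g, g \in G -> exists m n, [/\ m \in M, n \in N & g = m * n].
Proof.
move=> nNM g gG; have [MG _ maxK] := maxM; have [NG NJ] := nNG.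
have [|||K KP] := @groupClosedP gT
  (fun x => exists m n, [/\ m \in M, n \in N & x = m * n]).
- by exists 1, 1; rewrite !gpred1 mulg1.
- move=> _ _ [m [n [mM nN ->]]] [m' [n' [m'M n'N ->]]].
  exists (m * m'), (n ^ m' * n'); split; first exact: gpredM.
    by rewrite gpredM// NJ// MG.
  by rewrite conjgE !mulgA mulgK.
- move=> _ [m [n [mM nN ->]]]; exists m^-1, (n^-1 ^ m^-1); split.
  + by rewrite gpredV.
  + by rewrite NJ ?gpredV//; apply: MG.
  + by rewrite conjgE invgK invgM !mulgA mulVg mul1g.
have MK : {subset M <= K} by move=> m mM; apply/KP; exists m, 1; rewrite gpred1 mulg1.
have KG : {subset K <= G}.
  by move=> x /KP [m [n [/MG mG /NG nG ->]]]; rewrite gpredM.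
have [KM|KG'] := maxK K MK KG; last by apply/KP; rewrite KG'.
by case: nNM => n nN; rewrite -KM; apply/KP; exists 1, n; rewrite gpred1 mul1g.
Qed.

End MaximalSubgroups.

(** * Rooted trees *)

Local Notation root := Defs.root.

Section Tree.
Variable T : rooted_tree.
Implicit Types (u v w x y : T) (p : seq T) (g h : Aut T).

Fact root_path_subproof x : exists p, simple_path root x p.
Proof. by have [p [xp _]] := tree_path root x; exists p. Qed.

Definition root_path x : seq T := sval (cid (root_path_subproof x)).

Definition depth x : nat := size (root_path x).

Lemma root_pathP x : simple_path root x (root_path x).
Proof. exact: svalP (cid (root_path_subproof x)). Qed.

Lemma root_path_eq x p : simple_path root x p -> root_path x = p.
Proof.
by have [q [_ uq]] := tree_path root x => /uq <-; rewrite (uq _ (root_pathP x)).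
Qed.

Lemma last_root_path x : last root (root_path x) = x.
Proof. by have /andP[/andP[_ /eqP]] := root_pathP x. Qed.

Lemma root_path_inj : injective root_path.
Proof. by move=> x y e; rewrite -(last_root_path x) e last_root_path. Qed.

Lemma root_path_aut g x : root_path (g x) = map g (root_path x).
Proof.
by apply: root_path_eq; rewrite -(aut_root g); apply/aut_simple_path/root_pathP.
Qed.

Lemma depth_aut g x : depth (g x) = depth x.
Proof. by rewrite /depth root_path_aut size_map. Qed.

Lemma simple_path_take p n x : simple_path root x p ->
  simple_path root (last root (take n p)) (take n p).
Proof.
rewrite -{1}(cat_take_drop n p) /simple_path /is_path.
rewrite cat_path -cat_cons cat_uniq.
by move=> /andP[/andP[/andP[-> _] _] /andP[-> _]]; rewrite eqxx.
Qed.

Lemma root_path_take n x :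
  root_path (last root (take n (root_path x))) = take n (root_path x).
Proof. exact/root_path_eq/simple_path_take/root_pathP. Qed.

(** An initial segment of a simple path from the root is simple, hence by uniqueness the root path
    of its last vertex. *)
Lemma tree_leE v w : tree_le v w = prefix (root_path v) (root_path w).
Proof.
apply/asboolP/idP => [[p /root_path_eq <-]|/prefixP [q e]].
  rewrite inE => /orP[/eqP ->|vw]; 
    first by rewrite (@root_path_eq _ [::]) ?prefix0s// /simple_path /is_path /= eqxx.
  set q := root_path w in vw *.
  have e : take (index v q).+1 q = rcons (take (index v q) q) v.
    by rewrite (take_nth root) ?index_mem// nth_index.
  have := root_path_take (index v q).+1 w.
  by rewrite e last_rcons -e => ->; apply: prefix_take.
exists (root_path w); first exact: root_pathP.
by rewrite e -cat_cons mem_cat -{1}(last_root_path v) mem_last.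
Qed.

Lemma tree_le_trans u v w : tree_le u v -> tree_le v w -> tree_le u w.
Proof. by rewrite !tree_leE; apply: prefix_trans. Qed.

Lemma tree_le_depth v w : tree_le v w -> depth v <= depth w.
Proof. by rewrite tree_leE => /size_prefix. Qed.

Lemma tree_le_linear u v w :
  tree_le u w -> tree_le v w -> depth u <= depth v -> tree_le u v.
Proof.
rewrite !tree_leE !prefixE => /eqP uw /eqP vw uv.
by rewrite -vw take_takel ?uw.
Qed.

Lemma tree_le_eq v w : tree_le v w -> depth v = depth w -> v = w.
Proof.
rewrite tree_leE prefixE => /eqP + vw; rewrite [size _]vw take_size => e.
exact/esym/root_path_inj.
Qed.

Lemma tree_le_eq_depth u v w :
  tree_le u w -> tree_le v w -> depth u = depth v -> u = v.
Proof.
by move=> uw vw uv; apply: tree_le_eq => //; apply: tree_le_linear uw vw _; rewrite uv.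
Qed.

Lemma tree_le_autE g v w : tree_le (g v) (g w) = tree_le v w.
Proof.
apply/idP/idP; last exact: tree_le_aut.
by move=> /(tree_le_aut g^-1); rewrite !autVK.
Qed.

Lemma tree_le_autV g v w : tree_le v (g^-1 w) = tree_le (g v) w.
Proof. by rewrite -(tree_le_autE g) autKV. Qed.

Lemma ancestor n x : n <= depth x -> exists2 u, depth u = n & tree_le u x.
Proof.
move=> nx; exists (last root (take n (root_path x))).
  by rewrite /depth root_path_take size_takel.
by rewrite tree_leE root_path_take prefix_take.
Qed.

(** [shortenP] cuts any walk down to a simple path through some of its vertices, so the root path is
    a shortest walk. *)
Lemma levelE n x : level n x <-> depth x = n.
Proof.
have min p : is_path root x p -> depth x <= size p.
  move=> /andP[xp /eqP e]; rewrite -{}e; case: (shortenP xp) => p' xp' up' p'p.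
  rewrite /depth (@root_path_eq _ p'); last by rewrite /simple_path up' /is_path xp' eqxx.
  by apply: uniq_leq_size => //; case/andP: up'.
have xP : is_path root x (root_path x) by case/andP: (root_pathP x).
split=> [[[p xp <-] minp]|<-]; first by apply/eqP; rewrite eqn_leq min// minp.
by split=> //; exists (root_path x).
Qed.

Lemma finite_depth n : finite_set [set x | depth x <= n].
Proof.
elim: n => [|n IH].
  apply: sub_finite_set (finite_set1 root) => x /=; rewrite leqn0 => /nilP xr.
  by rewrite -(last_root_path x) xr.
apply: (@sub_finite_set _ _
  ([set x | depth x <= n] `|` \bigcup_(x in [set x | depth x <= n]) neighbours x)).
  move=> x /=; rewrite leq_eqVlt ltnS => /orP[/eqP xn|]; last by left.
  right; rewrite /depth in xn.
  case/lastP: (root_path x) (root_pathP x) xn => [|p y] // xp.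
  rewrite size_rcons => -[pn].
  have /andP[/andP[]] := xp; rewrite rcons_path last_rcons => /andP[_ py] /eqP yx _.
  exists (last root p); last by rewrite -yx.
  have := root_path_take (size p) x.
  by rewrite (root_path_eq xp) -cats1 take_size_cat//= /depth => ->; rewrite pn.
rewrite finite_setU; split=> //.
by apply: bigcup_finite => // x _; exact: tree_locally_finite.
Qed.

End Tree.

(** * Prodense subgroups of weakly branch groups *)

(** Equivalently, [M] meets every coset in [G] of every nontrivial normal subgroup. *)
Definition prodense (gT : groupType) (M G : groupClosed gT) : Prop :=
  forall N : groupClosed gT, normal_subgroup N G -> nontrivial N ->
  forall g, g \in G -> exists m n, [/\ m \in M, n \in N & g = m * n].

(** * Rigid stabilisers *)

Section RigidStabilisers.
Variables (T : rooted_tree) (G : groupClosed (Aut T)).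
Implicit Types (u v w x y : T) (g h : Aut T).

Lemma RistP v g :
  reflect (g \in G /\ forall w, ~~ tree_le v w -> g w = w) (g \in Rist G v).
Proof. by apply: (iffP andP) => -[gG /asboolP]. Qed.

Lemma Rist_sub v w : tree_le v w -> {subset Rist G w <= Rist G v}.
Proof.
move=> vw g /RistP [gG gw]; apply/RistP; split=> // x vx; apply: gw.
by apply: contra vx; exact: tree_le_trans.
Qed.

(** The only vertex of T_v this shallow is [v]. If [g v] lay outside T_v, then [g] would fix [g v],
    and injectivity would give [g v = v]. *)
Lemma Rist_fix v g x : g \in Rist G v -> depth x <= depth v -> g x = x.
Proof.
move=> /RistP [gG gv] xv; have [vx|/gv//] := boolP (tree_le v x).
have {}xv : depth v = depth x by apply/eqP; rewrite eqn_leq xv tree_le_depth.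
have e := tree_le_eq vx xv; rewrite -{x vx xv}e.
have [vgv|/gv] := boolP (tree_le v (g v)); last exact: (bij_inj (aut_bij g)).
by rewrite -(tree_le_eq vgv)// depth_aut.
Qed.

Lemma RistJ v g h : h \in G -> g \in Rist G v -> h * g * h^-1 \in Rist G (h v).
Proof.
move=> hG /RistP [gG gv]; apply/RistP; split; first by rewrite !gpredM// gpredV.
by move=> w vw; rewrite !autM gv ?autKV// tree_le_autV.
Qed.

Lemma Aut_neq1 g : g <> 1 -> exists x, g x <> x.
Proof.
move=> g1; apply: contrapT => /forallNP gx; apply: g1.
by apply: aut_inj => x; apply: contrapT => /gx.
Qed.

Hypothesis ristG : forall v, nontrivial (Rist G v).

Lemma Rist_moves v : exists g x, [/\ g \in Rist G v, tree_le v x & g x <> x].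
Proof.
have [g gv /Aut_neq1 [x gx]] := ristG v; exists g, x; split=> //.
by apply: contrapT => /negP vx; apply: gx; have /RistP [_ ->] := gv.
Qed.

Lemma depth_unbounded k : exists x : T, k <= depth x.
Proof.
elim: k => [|k [x kx]]; first by exists Defs.root.
have [g [y [gx xy gy]]] := Rist_moves x; exists y; apply: leq_ltn_trans kx _.
by rewrite ltnNge; apply/negP => /(Rist_fix gx).
Qed.

(** Descend along vertices [z i], each moved by the chosen element of the rigid stabiliser of its
    predecessor. The element at [z i] moves [z i.+1], which those at later vertices fix, so all of
    them are distinct. *)
Lemma Rist_sequence v : exists f : nat -> Aut T,
  (forall i, f i \in Rist G v) /\ injective f.
Proof.
have [g gP] := choice Rist_moves; have [y yP] := choice gP.
have gR x : g x \in Rist G x by case: (yP x).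
have xy x : tree_le x (y x) by case: (yP x).
have gy x : g x (y x) <> y x by case: (yP x).
pose z i := iter i y v.
have zle i j : i <= j -> tree_le (z i) (z j).
  move=> /subnK <-; elim: (j - i)%N => [|k IH]; first exact: tree_le_refl.
  exact: tree_le_trans IH (xy _).
have lt i j : i < j -> g (z i) <> g (z j).
  move=> ij e; apply: (gy (z i)); rewrite e (Rist_fix (gR _))//.
  exact/tree_le_depth/(zle i.+1).
exists (fun i => g (z i)); split=> [i|i j e]; first exact: Rist_sub (zle 0 i _) _ (gR _).
by case: (ltngtP i j) => // /lt; rewrite e.
Qed.

End RigidStabilisers.

Lemma ball_stabiliser (T : rooted_tree) (H : groupClosed (Aut T)) k :
  exists S : groupClosed (Aut T), forall g, g \in S <->
    (g \in H /\ forall x, depth x <= k -> g x = x).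
Proof.
apply: groupClosedP.
- by split; first exact: gpred1.
- move=> f h [fH fk] [hH hk]; split; first exact: gpredM.
  by move=> x xk; rewrite autM hk// fk.
- move=> f [fH fk]; split; first by rewrite gpredV.
  by move=> x xk; rewrite -[in LHS](fk x)// autVK.
Qed.

Section Prodense.
Variables (T : rooted_tree) (G M : groupClosed (Aut T)).
Implicit Types (u v w x y : T) (g h m n : Aut T).
Hypothesis transG : level_transitive G.
Hypothesis ristG : forall v, nontrivial (Rist G v).
Hypothesis MG : {subset M <= G}.
Hypothesis prodM : prodense M G.

Lemma dense_depth k g : g \in G ->
  exists2 m, m \in M & forall x, depth x <= k -> m x = g x.
Proof.
move=> gG; have [N NP] := ball_stabiliser G k.
have nN : normal_subgroup N G.
  split=> [f /NP []//|f h /NP [fG fk] hG]; apply/NP; split.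
    by rewrite conjgE !gpredM// gpredV.
  by move=> x xk; rewrite conjgE !autM fk ?depth_aut// autVK.
(* The rigid stabiliser of any vertex of depth at least [k] lies in the ball stabiliser. *)
have N1 : nontrivial N.
  have [x kx] := depth_unbounded ristG k; have [f fx f1] := ristG x.
  exists f => //; apply/NP; split; first by case/RistP: fx.
  by move=> y yk; apply: Rist_fix fx _; exact: leq_trans yk kx.
have [m [n [mM /NP [_ nk] ->]]] := prodM nN N1 gG.
by exists m => // x xk; rewrite autM nk.
Qed.

Lemma prodense_transitive x y : depth x = depth y -> exists2 m, m \in M & m x = y.
Proof.
move=> xy; have [g gG gx] : exists2 g, g \in G & g x = y.
  by apply: transG; [exact/levelE/erefl | apply/levelE].
by have [m mM mg] := dense_depth (depth x) gG; exists m; rewrite ?mg.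
Qed.

(** Membership in [H_v] is expressed on vertices of [T], without the subtree type. *)
Lemma vertex_groupP (H : groupClosed (Aut T)) v g : g v = v ->
  reflect (exists2 h, h \in H & forall x, tree_le v x -> h x = g x)
          (phi v g \in vertex_group H v).
Proof.
move=> gv; apply: (iffP idP) => [/asboolP [h /andP[hH /eqP hv] e]|[h hH hg]].
  exists h => // x vx; have := congr1 (fun k => val (aut_fun k (sub_vertex vx))) e.
  by rewrite !phiE.
have hv : h v = v by rewrite hg ?tree_le_refl.
apply/asboolP; exists h; first by rewrite inE hH hv eqxx.
by apply: aut_inj => x; apply: val_inj; rewrite !phiE// hg//; exact: valP x.
Qed.

Lemma phi_vertex_group (H : groupClosed (Aut T)) v g :
  g \in H -> g v = v -> phi v g \in vertex_group H v.
Proof. by move=> gH gv; apply/(vertex_groupP _ gv); exists g. Qed.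

(** Prodensity is applied to the rigid stabiliser [N] of the level of [v], described by its action
    on each T_u to avoid a product over the level. Conjugation permutes these subtrees, so [N] is
    normal, and it contains [Rist G v]. *)
Lemma Rist_supplement v g : g \in G -> g v = v -> exists m r,
  [/\ m \in M, m v = v, r \in Rist G v & phi v g = phi v m * phi v r].
Proof.
have [|||N NP] := @groupClosedP (Aut T) (fun n => n \in G /\
    forall u, depth u = depth v ->
    exists2 r, r \in Rist G u & forall x, tree_le u x -> n x = r x).
- split; first exact: gpred1.
  by move=> u _; exists 1 => //; exact: gpred1.
- move=> f h [fG fR] [hG hR]; split=> [|u uv]; first exact: gpredM.
  have [r rR fr] := fR u uv; have [s sR hs] := hR u uv.
  exists (r * s); first exact: gpredM.
  move=> x ux; rewrite !autM hs// fr//.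
  by rewrite -(Rist_fix sR (leqnn _)) tree_le_autE.
- move=> f [fG fR]; split=> [|u uv]; first by rewrite gpredV.
  have [r rR fr] := fR u uv; exists r^-1; first by rewrite gpredV.
  move=> x ux; apply: (bij_inj (aut_bij f)); rewrite autKV fr ?autKV//.
  by rewrite tree_le_autV (Rist_fix rR).
have nN : normal_subgroup N G.
  split=> [f /NP []//|f h /NP [fG fR] hG]; apply/NP; split=> [|u uv].
    by rewrite conjgE !gpredM// gpredV.
  have [|r rR fr] := fR (h u); first by rewrite depth_aut.
  exists (h^-1 * r * h).
    have hVG : h^-1 \in G by rewrite gpredV.
    by have := RistJ hVG rR; rewrite autVK invgK.
  by move=> x ux; rewrite conjgE !autM fr// tree_le_autE.
have N1 : nontrivial N.
  have [r rv r1] := ristG v; exists r => //; apply/NP; have /RistP [rG rx] := rv.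
  split=> // u uv; have [->|/eqP nuv] := eqVneq u v; first by exists r.
  exists 1 => [|x ux]; first exact: gpred1.
  by rewrite rx//; apply/negP => vx; apply: nuv; exact: tree_le_eq_depth ux vx uv.
move=> gG gv; have [m [n [mM /NP [_ nR] e]]] := prodM nN N1 gG.
have [r rR nr] := nR v erefl.
have rv : r v = v by exact: Rist_fix rR _.
have nv : n v = v by rewrite nr ?tree_le_refl.
have mv : m v = v by move: gv; rewrite e autM nv.
exists m, r; split=> //; rewrite e phiM//; congr (_ * _).
by apply: aut_inj => x; apply: val_inj; rewrite !phiE// nr//; exact: valP x.
Qed.

(* The elements all of whose M-translates stabilising v act on T_v through K;
   M-transitivity on the level of v makes this set a subgroup. *)
Lemma vertex_overgroup v (K : groupClosed (Aut (subtree v))) :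
  {subset vertex_group M v <= K} ->
  exists H : groupClosed (Aut T), forall g, g \in H <-> (g \in G /\
    {in M &, forall m1 m2, m2 (g (m1 v)) = v -> phi v (m2 * g * m1) \in K}).
Proof.
move=> MK; apply: groupClosedP.
- split; first exact: gpred1.
  move=> m1 m2 m1M m2M; rewrite mulg1 => e.
  by apply/MK/phi_vertex_group; first exact: gpredM.
- move=> g h [gG gK] [hG hK]; split=> [|m1 m2 m1M m2M e]; first exact: gpredM.
  (* Inserting [m] between [g] and [h] splits the product into two factors that both stabilise
     [v]. *)
  have [m mM mv] : exists2 m, m \in M & m (h (m1 v)) = v.
    by apply: prodense_transitive; rewrite !depth_aut.
  have -> : m2 * (g * h) * m1 = (m2 * g * m^-1) * (m * h * m1).
    by rewrite !mulgA mulgVK.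
  have mVv : m^-1 v = h (m1 v) by rewrite -{1}mv autVK.
  have m2v : m2 (g (m^-1 v)) = v by rewrite mVv.
  by rewrite phiM ?gpredM ?gK ?hK ?gpredV.
- move=> g [gG gK]; split=> [|m1 m2 m1M m2M e]; first by rewrite gpredV.
  have -> : m2 * g^-1 * m1 = (m1^-1 * g * m2^-1)^-1 by rewrite !invgM !invgK mulgA.
  have e' : m1^-1 (g (m2^-1 v)) = v by rewrite -{1}e autVK autKV autVK.
  by rewrite phiV ?gpredV ?gK ?gpredV.
Qed.

Lemma sub_vertex_overgroup v (K : groupClosed (Aut (subtree v)))
    (H : groupClosed (Aut T)) :
  {subset vertex_group M v <= K} ->
  (forall g, g \in H <-> (g \in G /\
    {in M &, forall m1 m2, m2 (g (m1 v)) = v -> phi v (m2 * g * m1) \in K})) ->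
  {subset M <= H}.
Proof.
move=> MK HP g gM; apply/HP; split=> [|m1 m2 m1M m2M e]; first exact: MG.
by apply/MK/phi_vertex_group; first exact/gpredM/m1M/gpredM.
Qed.

(** * Maximality and index of the vertex groups *)

Hypothesis maxM : forall K : groupClosed (Aut T),
  {subset M <= K} -> {subset K <= G} -> K =i M \/ K =i G.

Lemma vertex_group_maximal v (K : groupClosed (Aut (subtree v))) :
  {subset vertex_group M v <= K} -> {subset K <= vertex_group G v} ->
  K =i vertex_group M v \/ K =i vertex_group G v.
Proof.
move=> MK KG; have [H HP] := vertex_overgroup MK.
have HG : {subset H <= G} by move=> g /HP [].
have [HM|HG'] := maxM (sub_vertex_overgroup MK HP) HG; [left|right] => k.
  apply/idP/idP; last exact: MK.
  move=> kK; have /asboolP [g /andP[gG /eqP gv] gk] := KG _ kK.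
  have [m [r [mM mv rR e]]] := Rist_supplement gG gv.
  have rv : r v = v by exact: Rist_fix rR _.
  have mM' := phi_vertex_group mM mv.
  rewrite -gk e gpredM//; apply: phi_vertex_group => //; rewrite -HM.
  have rK : phi v r \in K.
    rewrite (_ : phi v r = (phi v m)^-1 * k); first by rewrite gpredM// gpredV MK.
    by rewrite -gk e mulKg.
  have /RistP [rG rx] := rR.
  (* The aim is [r \in H], that is [r \in M]. Either [m1], hence also [m2], fixes [v], and each
     factor acts through [K]; or [m1 v] differs from [v], and [r], trivial below [m1 v], drops out
     of the action on T_v. *)
  apply/HP; split=> // m1 m2 m1M m2M e'.
  have rm1 : r (m1 v) = m1 v by apply: Rist_fix rR _; rewrite depth_aut.
  have [m1v|m1v] := eqVneq (m1 v) v.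
    have m2v : m2 v = v by rewrite -[RHS]e' m1v rv.
    rewrite phiM ?phiM ?autM ?rv// !gpredM//; exact/MK/phi_vertex_group.
  apply/MK/vertex_groupP => //; exists (m2 * m1); first exact: gpredM.
  move=> x vx; rewrite !autM rx//; apply: contra m1v => vm1x; apply/eqP.
  apply/esym; apply: tree_le_eq_depth vm1x _ _; rewrite ?depth_aut//.
  by rewrite tree_le_autE.
apply/idP/idP; first exact: KG.
move=> /asboolP [g /andP[gG /eqP gv] <-]; move: gG; rewrite -HG' => /HP [_ gK].
by have := gK 1 1 gpred1 gpred1; rewrite mul1g mulg1; apply.
Qed.

Lemma vertex_group_finite_index v :
  ~ {subset vertex_group G v <= vertex_group M v} ->
  finite_index (vertex_group M v) (vertex_group G v) -> finite_index M G.
Proof.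
move=> nGMv /finite_index_transversal [I [f fP]].
have MK : {subset vertex_group M v <= vertex_group M v} by [].
have [H HP] := vertex_overgroup MK.
have HG : {subset H <= G} by move=> g /HP [].
have HM : H =i M.
  have [//|HG'] := maxM (sub_vertex_overgroup MK HP) HG.
  case: nGMv => _ /asboolP [g /andP[gG /eqP gv] <-]; move: gG; rewrite -HG' => /HP [_ gK].
  by have := gK 1 1 gpred1 gpred1; rewrite mul1g mulg1; apply.
(* On the level of [v], [t u] is an element of [M] carrying [v] to [u]. *)
have [u|t tP] := @choice _ _
  (fun u (m : Aut T) => depth u = depth v -> m \in M /\ m v = u).
  have [e|ne] := eqVneq (depth u) (depth v); last by exists 1 => e; rewrite e eqxx in ne.
  by have [m mM mv] := prodense_transitive (esym e); exists m.
have /finite_seqP [s es] := finite_depth T (depth v).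
have sP u : depth u = depth v -> u \in s.
  by move=> e; have : [set` s] u by rewrite -es /= e.
(* For [u] on the level of [v], [F g] records the vertex [g u] and the [f]-label of the element of
   [G_v] obtained by transporting the map from T_u to T_(g u) back to T_v through [t]. Entries at
   smaller depth are never consulted. *)
pose F g := [ffun i : 'I_(size s) => let u := nth v s i in
  (inord (index (g u) s) : 'I_(size s).+1, f (phi v ((t (g u))^-1 * g * t u)))].
apply: (@finite_index_of_separation _ _ _ _ F) => g g' gG g'G eF.
have {eF} eF u : depth u = depth v ->
    g u = g' u /\ phi v ((t u)^-1 * (g^-1 * g') * t u) \in vertex_group M v.
  move=> uv; have us := sP _ uv; have := us; rewrite -index_mem => ui.
  have := congr1 (fun h : {ffun 'I_(size s) -> _} => h (Ordinal ui)) eF.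
  rewrite !ffunE /= nth_index// => -[/(congr1 val) /=].
  have ls w : index w s < (size s).+1 by rewrite ltnS index_size.
  rewrite !inordK// => egu.
  have {}egu : g' u = g u.
    by rewrite -[RHS](nth_index v (sP _ _)) ?depth_aut// egu nth_index// sP// depth_aut.
  rewrite egu => ef; split=> //.
  have [tu tuv] := tP u uv; have [|tgu tguv] := tP (g u); first by rewrite depth_aut.
  have stab h : h \in G -> h u = g u ->
      phi v ((t (g u))^-1 * h * t u) \in vertex_group G v /\
      ((t (g u))^-1 * h * t u) v = v.
    move=> hG hu; have e : ((t (g u))^-1 * h * t u) v = v.
      by rewrite !autM tuv hu -{2}tguv autVK.
    by split=> //; apply: phi_vertex_group => //; rewrite !gpredM ?gpredV//; exact: MG.
  have [gGv gv] := stab g gG erefl; have [g'Gv g'v] := stab g' g'G egu.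
  have := fP _ _ gGv g'Gv ef; rewrite -phiV// -phiM//; last by rewrite fix_inv.
  by rewrite !invgM invgK !mulgA mulgK.
rewrite -HM; apply/HP; split=> [|m1 m2 m1M m2M e]; first by rewrite gpredM ?gpredV.
have [|eg gM] := eF (m1 v); first by rewrite depth_aut.
have [|tM tv] := tP (m1 v); first by rewrite depth_aut.
have gm1 : (g^-1 * g') (m1 v) = m1 v by rewrite autM -eg autVK.
(* All three factors stabilise [v]; the outer two lie in [M], and the middle one is controlled by
   [F]. *)
have -> : m2 * (g^-1 * g') * m1 =
    (m2 * t (m1 v)) * ((t (m1 v))^-1 * (g^-1 * g') * t (m1 v)) * ((t (m1 v))^-1 * m1).
  by rewrite !mulgA !mulgK.
have m2v : (m2 * t (m1 v)) v = v by rewrite autM tv -[RHS]e gm1.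
have m1v : ((t (m1 v))^-1 * m1) v = v by rewrite autM -{2}tv autVK.
have gv : ((t (m1 v))^-1 * (g^-1 * g') * t (m1 v)) v = v.
  by rewrite 2!autM tv gm1 -{2}tv autVK.
have aM : m2 * t (m1 v) \in M by exact: gpredM.
have cM : (t (m1 v))^-1 * m1 \in M by rewrite gpredM ?gpredV.
rewrite (phiM _ m1v); last by rewrite autM gv.
rewrite (phiM m2v gv); apply: gpredM; last exact: phi_vertex_group.
by apply: gpredM => //; exact: phi_vertex_group.
Qed.


End Prodense.

(** * Properness of the vertex groups *)

Lemma nat_fin_collision (I : finType) (f : nat -> I) :
  exists i j, i <> j /\ f i = f j.
Proof.
have /injectivePn [i [j /eqP ij fij]] : ~~ injectiveb (fun k : 'I_#|I|.+1 => f k).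
  by apply/negP => /injectiveP /leq_card; rewrite card_ord ltnn.
by exists i, j; split=> // /val_inj.
Qed.

Lemma sub_in_count_ltn (A : eqType) (P Q : pred A) (s : seq A) a :
  a \in s -> ~~ P a -> Q a -> {in s, forall x, P x -> Q x} -> count P s < count Q s.
Proof.
move=> + Pa Qa; elim: s => //= b s IH; rewrite inE => abs PQ.
have Pb : P b <= Q b by case Pb : (P b) => //; rewrite PQ// inE eqxx.
have PQs : {in s, forall x, P x -> Q x} by move=> x xs; apply: PQ; rewrite inE xs orbT.
have le : count P s <= count Q s.
  rewrite (@eq_in_count _ _ (predI P Q)); first by apply: sub_count => x /andP[].
  by move=> x /PQs /=; case: (P x) => // ->.
case/orP: abs => [/eqP <-|/IH lt]; last by rewrite -addnS leq_add// lt.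
by rewrite (negbTE Pa) Qa add0n add1n ltnS.
Qed.

Section ProperVertexGroup.
Variables (T : rooted_tree) (G M : groupClosed (Aut T)).
Implicit Types (t u v w x y z : T) (a b c f g h m r : Aut T).
Hypothesis ristG : forall v, nontrivial (Rist G v).
Hypothesis prodM : prodense M G.

Variable n : nat.

(** This is the inclusion of [G_u] in [M_u] along level [n], the situation to be refuted. *)
Hypothesis fullM : forall u g, depth u = n -> g \in G -> g u = u ->
  exists2 m, m \in M & forall x, tree_le u x -> m x = g x.

Variable S : groupClosed (Aut T).
Hypothesis SP : forall g, g \in S <-> (g \in M /\ forall x, depth x <= n -> g x = x).

Let SM : {subset S <= M}. Proof. by move=> g /SP []. Qed.

Let S_fix u g : depth u <= n -> g \in S -> g u = u.
Proof. by move=> un /SP [_ ->]. Qed.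

Let S_le u x g : depth u = n -> g \in S -> tree_le u (g x) = tree_le u x.
Proof. by move=> un gS; rewrite -{1}(@S_fix u g) ?un ?tree_le_autE. Qed.

(** Nothing is asked outside T_u: a lift from [G] to [M] is controlled on one subtree only. *)
Definition acts_as_Rist u w m :=
  exists2 r, r \in Rist G w & forall x, tree_le u x -> m x = r x.

Lemma acts_as_Rist_fix u w m x : acts_as_Rist u w m ->
  tree_le u x -> ~~ tree_le w x -> m x = x.
Proof. by move=> [r /RistP [_ rw] mr] ux /rw; rewrite mr. Qed.

Lemma acts_as_Rist_le u w m x : acts_as_Rist u w m ->
  tree_le u w -> tree_le w x -> tree_le w (m x).
Proof.
move=> [r rw mr] uw wx; rewrite mr; last exact: tree_le_trans uw wx.
by rewrite -(Rist_fix rw (leqnn _)) tree_le_autE.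
Qed.

(* Among infinitely many elements of Rist_G(w), two have lifts to M inducing the
   same permutation of the vertices of depth at most n. *)
Lemma S_acts_as_Rist u w : depth u = n -> tree_le u w ->
  exists m x, [/\ m \in S, acts_as_Rist u w m, tree_le w x & m x <> x].
Proof.
move=> un uw; have [f [fR finj]] := Rist_sequence ristG w.
have [i|m mP] := @choice _ _
  (fun i m => m \in M /\ forall x, tree_le u x -> m x = f i x).
  have /RistP [fG _] := fR i.
  have fu : f i u = u by apply: Rist_fix (fR i) _; exact: tree_le_depth.
  by have [m mM mf] := fullM un fG fu; exists m.
have fu k : f k u = u by apply: Rist_fix (fR k) _; exact: tree_le_depth.
have fVu k : (f k)^-1 u = u by rewrite -{1}(fu k) autVK.
have /finite_seqP [s es] := finite_depth T n.
have sP x : (depth x <= n) = (x \in s).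
  apply/idP/idP => xn; first by have : [set` s] x by rewrite -es.
  by have : [set x | depth x <= n] x by rewrite es.
have [i [j [ij]]] := nat_fin_collision (fun i =>
  [ffun k : 'I_(size s) => inord (index (m i (nth u s k)) s) : 'I_(size s).+1]).
move=> eF; have [miM mif] := mP i; have [mjM mjf] := mP j.
have e x : depth x <= n -> m i x = m j x.
  move=> xn; have xs := xn; rewrite sP -index_mem in xs.
  have := congr1 (fun h : {ffun 'I_(size s) -> _} => h (Ordinal xs)) eF.
  rewrite !ffunE /= nth_index -?sP// => /(congr1 val) /=.
  rewrite !inordK ?ltnS ?index_size// => e.
  rewrite -[LHS](@nth_index _ u _ s) ?e ?nth_index -?sP ?depth_aut//.
have rR : (f i)^-1 * f j \in Rist G w by rewrite gpredM ?gpredV.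
have mS : (m i)^-1 * m j \in S.
  by apply/SP; split=> [|x xn]; rewrite ?gpredM ?gpredV// autM -e// autVK.
have mr x : tree_le u x -> ((m i)^-1 * m j) x = ((f i)^-1 * f j) x.
  move=> ux; rewrite !autM mjf// -{1}[f j x](autKV (f i)) -mif ?autVK//.
  by rewrite -(fVu i) -(fu j) !tree_le_autE.
have [x rx] : exists x, ((f i)^-1 * f j) x <> x.
  apply: Aut_neq1 => r1; apply/ij/finj.
  by rewrite -[RHS]mul1g -(mulgV (f i)) -mulgA r1 mulg1.
have wx : tree_le w x.
  by apply: contrapT => /negP wx; apply: rx; have /RistP [_ ->] := rR.
exists ((m i)^-1 * m j), x; split=> //; first by exists ((f i)^-1 * f j).
by rewrite mr//; exact: tree_le_trans uw wx.
Qed.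

(** Let [m1] move [x], and let [m2], supported in T_x as far as T_u is concerned, move [y]. Then
    [m1 y] has left T_x, so [m2] fixes it although it moves [y]. *)
Lemma S_noncommuting u w : depth u = n -> tree_le u w ->
  exists m1 m2 x, [/\ m1 \in S, m2 \in S, acts_as_Rist u w m1,
    acts_as_Rist u w m2 & tree_le w x /\ m1 (m2 x) <> m2 (m1 x)].
Proof.
move=> un uw; have [m1 [x [m1S m1R wx m1x]]] := S_acts_as_Rist un uw.
have ux := tree_le_trans uw wx.
have [m2 [y [m2S m2R xy m2y]]] := S_acts_as_Rist un ux.
exists m1, m2, y; split=> //.
  by have [r rR m2r] := m2R; exists r => //; exact: Rist_sub rR.
split; first exact: tree_le_trans xy.
have -> : m2 (m1 y) = m1 y.
  apply: acts_as_Rist_fix m2R _ _; first by rewrite S_le//; exact: tree_le_trans xy.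
  apply/negP => xm1y; apply: m1x; apply: tree_le_eq_depth (tree_le_aut m1 xy) xm1y _.
  exact: depth_aut.
by move=> /(bij_inj (aut_bij m1)).
Qed.

(** * Commutators and the shrinking of supports *)

Definition trivial_below t g := forall x, tree_le t x -> g x = x.

Let comm a b := a * b * a^-1 * b^-1.

Lemma trivial_below_comm t a b : depth t = n -> a \in S -> b \in S ->
  trivial_below t a -> trivial_below t (comm a b).
Proof.
move=> tn aS bS at1 x tx; rewrite /comm !autM.
have tb : tree_le t (b^-1 x) by rewrite S_le ?gpredV.
by rewrite -{1}(at1 _ tb) autVK autKV at1.
Qed.

Lemma trivial_below_commute t a b : depth t = n -> a \in S -> b \in S ->
  (forall x, tree_le t x -> a (b x) = b (a x)) -> trivial_below t (comm a b).
Proof.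
move=> tn aS bS ab x tx.
have -> : x = b (a (a^-1 (b^-1 x))) by rewrite !autKV.
rewrite /comm !autM autVK autVK ab// !S_le ?gpredV//.
Qed.

(* Shrinking the support: [comm a m2], with [a] a commutator of [c], is nontrivial
   on T_u; if it is nontrivial on T_u' too, then conjugating m2 by an element h of M
   which is trivial on T_u' up to large depth but moves the support of m2 in T_u
   off that of [a] kills the commutator on T_u only. *)
Lemma shrink_support u u' c : depth u = n -> depth u' = n -> u' <> u ->
  c \in S -> ~ trivial_below u c ->
  exists f, [/\ f \in S, f <> 1, trivial_below u f \/ trivial_below u' f &
    forall t, depth t = n -> trivial_below t c -> trivial_below t f].
Proof.
move=> un u'n u'u cS /existsNP [w0 /not_implyP [uw0 cw0]].
(* The vertices [w], [g w], [c w] have equal depth and are distinct, as [g] keeps [w] below [w0] and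
   [c] does not. Their subtrees are disjoint. *)
have [g [w [gR w0w gw]]] := Rist_moves ristG w0.
have uw := tree_le_trans uw0 w0w.
have gw0 : g w0 = w0 by exact: Rist_fix gR _.
have cw : c w <> w.
  move=> e; apply: cw0; apply: (@tree_le_eq_depth _ _ _ w); rewrite ?depth_aut//.
  by rewrite -e tree_le_autE.
have gcw : g w <> c w.
  move=> e; apply: cw0; apply: (@tree_le_eq_depth _ _ _ (c w));
    rewrite ?depth_aut ?tree_le_autE//.
  by rewrite -e -gw0 tree_le_autE.
have [m1 [m2 [x0 [m1S m2S m1R m2R [wx0 nc]]]]] := S_noncommuting un uw.
(* On T_u the factor [c * m1^-1 * c^-1] acts only below [c w]. So [a] acts as [m1] below [w] and
   trivially below [g w]. *)
pose a := comm c m1^-1; have aE : a = c * m1^-1 * c^-1 * m1 by rewrite /a /comm invgK.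
have aS : a \in S by rewrite aE !gpredM ?gpredV.
have supp_a t : depth t = n -> trivial_below t c -> trivial_below t a.
  by move=> tn ct; apply: trivial_below_comm => //; rewrite gpredV.
clearbody a.
have m1V x : m1 x = x -> m1^-1 x = x by move=> e; rewrite -{1}e autVK.
have aE' x : ~~ tree_le (c w) (m1 x) -> tree_le u x -> a x = m1 x.
  move=> cwx ux; rewrite aE !autM m1V ?autKV//.
  by apply: (acts_as_Rist_fix m1R); [rewrite !S_le ?gpredV | rewrite tree_le_autV].
have a_w x : tree_le w x -> a x = m1 x.
  move=> wx; have wm1x := acts_as_Rist_le m1R uw wx.
  apply: aE'; last exact: tree_le_trans uw wx.
  by apply/negP => cwx; apply: cw; exact: tree_le_eq_depth cwx wm1x (depth_aut _ _).
have a_gw x : tree_le (g w) x -> a x = x.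
  have ugw : tree_le u (g w) by apply: tree_le_trans uw0 _; rewrite -gw0 tree_le_autE.
  move=> gwx; have ux := tree_le_trans ugw gwx.
  have m1x : m1 x = x.
    apply: acts_as_Rist_fix m1R ux _; apply/negP => wx; apply: gw.
    exact: tree_le_eq_depth gwx wx (depth_aut _ _).
  rewrite aE' ?m1x//; apply/negP => cwx; apply: gcw.
  by apply: tree_le_eq_depth gwx cwx _; rewrite !depth_aut.
(* The commutator of [a] and [m2] sends [m2 (m1 x0)] to [m1 (m2 x0)]. *)
pose y0 := m2 (m1 x0).
have ey0 : comm a m2 y0 <> y0.
  rewrite /y0 -a_w// /comm !autM !autVK !a_w//.
  exact: acts_as_Rist_le m2R uw wx0.
have supp t b : b \in S -> depth t = n -> trivial_below t c -> trivial_below t (comm a b).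
  by move=> bS tn ct; apply: trivial_below_comm => //; exact: supp_a.
have commS b : b \in S -> comm a b \in S by move=> bS; rewrite !gpredM ?gpredV.
have [e1|/existsNP [y /not_implyP [u'y ey]]] := pselect (trivial_below u' (comm a m2)).
  exists (comm a m2); split; [exact: commS| |by right|by move=> t; exact: supp].
  by move=> e; apply: ey0; rewrite e aut1.
(* Depth [w] ensures [h w = g w]; depth [y] makes [h] fix all vertices of T_u' as deep as [y]. *)
pose k := maxn (depth y) (depth w).
have gG : g \in G by case/RistP: gR.
have [h hM hg] := dense_depth ristG prodM k gG.
have hS : h \in S.
  apply/SP; split=> // x xn.
  have xw0 : depth x <= depth w0 by rewrite (leq_trans xn)// -un tree_le_depth.
  rewrite hg; first exact: Rist_fix gR xw0.
  by rewrite (leq_trans xw0)// (leq_trans (tree_le_depth w0w))// leq_maxr.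
have hw : h w = g w by rewrite hg// leq_maxr.
(* Within T_u, [b] acts only below [g w], where [a] is trivial, so [a] and [b] commute there. *)
pose b := h * m2 * h^-1.
have bS : b \in S by rewrite !gpredM ?gpredV.
have b_fix x : tree_le u x -> ~~ tree_le (g w) x -> b x = x.
  move=> ux gwx; rewrite /b !autM (acts_as_Rist_fix m2R) ?autKV//.
    by rewrite S_le ?gpredV.
  by rewrite tree_le_autV hw.
have b_le x : tree_le (g w) x -> tree_le (g w) (b x).
  rewrite /b !autM -hw tree_le_autE -tree_le_autV; exact: acts_as_Rist_le m2R uw.
exists (comm a b); split; [exact: commS| |left|by move=> t; exact: supp]; last first.
  apply: trivial_below_commute => // x ux.
  have [gwx|gwx] := boolP (tree_le (g w) x); first by rewrite !a_gw// b_le.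
  rewrite (b_fix x)// b_fix//; first by rewrite S_le.
  apply: contra gwx => gwax.
  by rewrite -(bij_inj (aut_bij a) (a_gw _ gwax)).
have h_fix z : tree_le u' z -> depth z = depth y -> h z = z.
  move=> u'z zy; rewrite hg ?zy ?leq_maxl//; have /RistP [_ -> //] := gR.
  apply/negP => w0z; apply: u'u; apply: tree_le_eq_depth u'z _ _; last by rewrite un.
  exact: tree_le_trans uw0 w0z.
have hV_fix z : tree_le u' z -> depth z = depth y -> h^-1 z = z.
  by move=> u'z zy; rewrite -{1}(h_fix z)// autVK.
(* Applied to [y], every [h] in the commutator cancels, leaving that of [a] and [m2], which moves
   [y]. *)
move=> f1; apply: ey; have := congr1 (fun q : Aut T => q y) f1.
rewrite /comm /b !invgM !invgK !autM aut1.
by do ?[rewrite h_fix ?depth_aut ?S_le ?gpredV//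
      | rewrite hV_fix ?depth_aut ?S_le ?gpredV//].
Qed.

(** Induction on [supp c], which [shrink_support] lowers while two subtrees are moved. Once only T_u
    is left, [c] fixes everything outside it. *)
Lemma Rist_nontrivial_of_support (s : seq T) c :
  (forall u, u \in s <-> depth u = n) -> c \in S -> c <> 1 ->
  exists u, depth u = n /\ nontrivial (Rist M u).
Proof.
move=> sP; pose supp f := count (fun u => ~~ `[< trivial_below u f >]) s.
have [k] := ubnP (supp c); elim: k c => // k IH c ck cS c1.
have [x cx] := Aut_neq1 c1.
have nx : n <= depth x.
  by rewrite leqNgt; apply/negP => /ltnW xn; apply: cx; exact: S_fix xn cS.
have [u un ux] := ancestor nx.
have uc : ~ trivial_below u c by move=> /(_ x ux).
have [/existsNP [u' /not_implyP [u'n /not_implyP [u'u u'c]]]|sgl] :=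
    pselect (~ forall t, depth t = n -> t <> u -> trivial_below t c).
  have [f [fS f1 fu fc]] := shrink_support un u'n u'u cS uc.
  apply: (IH f) => //; apply: leq_trans (ck : supp c <= k).
  have lt t : depth t = n -> ~ trivial_below t c -> trivial_below t f ->
      supp f < supp c.
    move=> tn tc tf; apply: (@sub_in_count_ltn _ _ _ _ t).
    - exact/sP.
    - by apply/negPn/asboolP.
    - exact/asboolPn.
    - move=> w /sP wn; apply: contra => /asboolP wc; apply/asboolP; exact: fc.
  by case: fu => [/(lt u)|/(lt u')]; apply.
exists u; split=> //; exists c => //; apply/RistP; split=> [|y uy]; first exact: SM.
have [yn|/ltnW ny] := leqP (depth y) n; first exact: S_fix yn cS.
have [t tn ty] := ancestor ny; apply: (contrapT sgl _ tn _ _ ty) => tu.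
by move: uy; rewrite -tu ty.
Qed.

Lemma Rist_nontrivial_of_full v : depth v = n ->
  exists u, depth u = n /\ nontrivial (Rist M u).
Proof.
move=> vn; have [m [x [mS _ _ mx]]] := S_acts_as_Rist vn (tree_le_refl v).
have /finite_seqP [s es] := finite_depth T n.
apply: (@Rist_nontrivial_of_support [seq u <- s | depth u == n] m) => //.
  move=> u; rewrite mem_filter; split=> [/andP[/eqP //]|un]; rewrite un eqxx /=.
  by have : [set` s] u by rewrite -es /= un.
by move=> m1; apply: mx; rewrite m1.
Qed.

End ProperVertexGroup.

Lemma vertex_group_proper (T : rooted_tree) (G M : groupClosed (Aut T)) v :
  level_transitive G -> (forall v, nontrivial (Rist G v)) -> {subset M <= G} ->
  prodense M G -> ~ {subset G <= M} -> ~ {subset vertex_group G v <= vertex_group M v}.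
Proof.
move=> transG ristG MG prodM nGM GMv.
have transM := prodense_transitive transG ristG prodM.
(* Conjugation by an element of [M] carries the assumption from [v] to its whole level. *)
have fullM u g : depth u = depth v -> g \in G -> g u = u ->
    exists2 m, m \in M & forall x, tree_le u x -> m x = g x.
  move=> uv gG gu; have [t tM tv] := transM v u (esym uv).
  have ev : (t^-1 * g * t) v = v by rewrite !autM tv gu -tv autVK.
  have : phi v (t^-1 * g * t) \in vertex_group G v.
    by apply: phi_vertex_group => //; rewrite !gpredM ?gpredV// MG.
  move=> /GMv /(vertex_groupP _ ev) [m mM mg].
  exists (t * m * t^-1); first by rewrite !gpredM ?gpredV.
  move=> x ux; rewrite !autM mg ?autM ?autKV//.
  by rewrite tree_le_autV tv.
have [S SP] := ball_stabiliser M (depth v).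
have [u [uv [r rM r1]]] := Rist_nontrivial_of_full ristG prodM fullM SP erefl.
(* [C] is the core of [M] in [G]; it will turn out to contain [r]. *)
have [|||C CP] := @groupClosedP (Aut T)
  (fun c => c \in M /\ forall g, g \in G -> g * c * g^-1 \in M).
- by split=> [|g gG]; rewrite ?mulg1 ?mulgV gpred1.
- move=> f h [fM fJ] [hM hJ]; split=> [|g gG]; first exact: gpredM.
  rewrite (_ : g * (f * h) * g^-1 = (g * f * g^-1) * (g * h * g^-1)).
    by rewrite gpredM ?fJ ?hJ.
  by rewrite !mulgA mulgVK.
- move=> f [fM fJ]; split=> [|g gG]; first by rewrite gpredV.
  by rewrite -gpredV !invgM !invgK mulgA fJ.
have nC : normal_subgroup C G.
  split=> [f /CP [/MG]//|f h /CP [fM fJ] hG]; apply/CP; split=> [|g gG].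
    by have := fJ h^-1; rewrite invgK conjgE mulgA; apply; rewrite gpredV.
  have := fJ (g * h^-1); rewrite invgM invgK conjgE !mulgA; apply.
  by rewrite gpredM ?gpredV.
have C1 : nontrivial C.
  exists r => //; have /RistP [rM' rx] := rM; apply/CP; split=> // g gG.
  have [m mM mu] := transM u (g u) (esym (depth_aut g u)).
  have su : (m^-1 * g) u = u by rewrite autM -mu autVK.
  have sG : m^-1 * g \in G by rewrite gpredM// gpredV MG.
  have [m' m'M m's] := fullM u _ uv sG su.
  have m'u : m' u = u by rewrite m's ?tree_le_refl.
  (* Since [r] is supported on T_u, where [m^-1 * g] and [m'] agree, both conjugate it alike; thus
     [g * r * g^-1] is an [M]-conjugate of [r]. *)
  have e : (m^-1 * g) * r * (m^-1 * g)^-1 = m' * r * m'^-1.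
    set q := m^-1 * g in su sG m's *. clearbody q.
    have qV x : tree_le u (q^-1 x) = tree_le u x by rewrite tree_le_autV su.
    have m'V x : tree_le u (m'^-1 x) = tree_le u x by rewrite tree_le_autV m'u.
    apply: aut_inj => x; rewrite !autM.
    have [ux|ux] := boolP (tree_le u x); last by rewrite !rx ?qV ?m'V// !autKV.
    have -> : m'^-1 x = q^-1 x by rewrite -{1}[x](autKV q) -m's ?qV// autVK.
    by rewrite m's// -(Rist_fix rM (leqnn _)) tree_le_autE qV.
  rewrite (_ : g * r * g^-1 = m * (m' * r * m'^-1) * m^-1).
    by rewrite !gpredM ?gpredV.
  by rewrite -e invgM invgK !mulgA mulgV mul1g mulgK.
apply: nGM => g gG; have [m [n [mM /CP [nM _] ->]]] := prodM C nC C1 g gG.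
exact: gpredM.
Qed.

Theorem theorem3p3 (T : rooted_tree) (G : groupClosed (Aut T))
    (hG : weakly_branch G)
    (hQ : forall (N : groupClosed (Aut T)) (nNG : normal_subgroup N G),
        nontrivial N -> MF (quotient nNG))
    (M : groupClosed (Aut T))
    (maxM : maximal_subgroup M G) (infM : ~ finite_index M G) (v : T) :
  maximal_subgroup (vertex_group M v) (vertex_group G v) /\
  ~ finite_index (vertex_group M v) (vertex_group G v).
Proof.
have [_ transG ristG] := hG; have [MG nGM maxK] := maxM.
have prodM : prodense M G.
  (* A nontrivial normal subgroup inside [M] would force finite index. *)
  move=> N nNG N1; apply: maximal_mul_normal => // NM.
  exact: infM (maximal_quotient maxM NM (hQ _ nNG N1)).
have nGMv := vertex_group_proper transG ristG MG prodM nGM (v := v).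
split; last by move=> /(vertex_group_finite_index transG ristG MG prodM maxK nGMv).
split=> //.
  move=> _ /asboolP [g /andP[gM /eqP gv] <-].
  by apply: phi_vertex_group; first exact: MG.
move=> K; exact: (vertex_group_maximal transG ristG MG prodM maxK).
Qed.
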